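(* Let $(p_{1,n})_{n\ge 1}$, $(q_{1,n})_{n\ge 1}$, $(p_{2,m})_{m\ge 1}$, $(q_{2,m})_{m\ge 1}$ be sequences of real numbers with $0<q_{1,n}<p_{1,n}\le 1$ and $0<q_{2,m}<p_{2,m}\le 1$ for all $n,m\ge 1$. Suppose that $$\lim_{n\to\infty}p_{1,n}=1,\quad \lim_{n\to\infty}q_{1,n}=1,\quad \lim_{m\to\infty}p_{2,m}=1,\quad \lim_{m\to\infty}q_{2,m}=1,\quad \lim_{n\to\infty}p_{1,n}^{\,n}=a_1,\quad \lim_{m\to\infty}p_{2,m}^{\,m}=a_2,$$ where $a_1,a_2$ are real numbers. Then for each $f\in C([0,1]^2)$, the functions $(x,y)\mapsto B^{(p_{1,n},q_{1,n}),(p_{2,m},q_{2,m})}_{n,m}(f;x,y)$ converge uniformly to $f(x,y)$ on $[0,1]^2$ as $n,m\to\infty$.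
   Context: For $0<q<p\le 1$ and an integer $n\ge 0$, put $[n]_{p,q}=\frac{p^n-q^n}{p-q}$, $[n]_{p,q}!=[n]_{p,q}[n-1]_{p,q}\cdots[1]_{p,q}$ for $n\ge 1$, $[0]_{p,q}!=1$, and, for $0\le k\le n$, $\binom{n}{k}_{p,q}=\frac{[n]_{p,q}!}{[k]_{p,q}!\,[n-k]_{p,q}!}$. For $n\ge 1$ and $0\le k\le n$ let $$R_{n,k}(p,q;x)=p^{\frac{k(k-1)-n(n-1)}{2}}\binom{n}{k}_{p,q}x^k\prod_{s=0}^{n-k-1}(p^s-q^s x)$$ (an empty product equals $1$). For $0<q_1<p_1\le 1$, $0<q_2<p_2\le 1$, integers $n,m\ge 1$, $f:[0,1]^2\to\mathbb{R}$ and $(x,y)\in[0,1]^2$, the bivariate $(p,q)$-Bernstein operator is $$B^{(p_1,q_1),(p_2,q_2)}_{n,m}(f;x,y)=\sum_{k=0}^{n}\sum_{j=0}^{m}R_{n,k}(p_1,q_1;x)\,R_{m,j}(p_2,q_2;y)\,f\!\left(\frac{[k]_{p_1,q_1}}{[n]_{p_1,q_1}p_1^{k-n}},\frac{[j]_{p_2,q_2}}{[m]_{p_2,q_2}p_2^{j-m}}\right).$$ $C([0,1]^2)$ is the space of continuous real-valued functions on $[0,1]^2$ with the norm $\|f\|_{C([0,1]^2)}=\sup_{(x,y)\in[0,1]^2}|f(x,y)|$. *)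

(* Defs.v *)
From HB Require Import structures.
From mathcomp Require Import all_boot all_order all_algebra.
From mathcomp Require Import all_classical all_reals all_analysis.

Set Implicit Arguments.
Unset Strict Implicit.
Unset Printing Implicit Defensive.

Import Order.TTheory GRing.Theory Num.Theory.
Import numFieldNormedType.Exports.

Local Open Scope classical_set_scope.
Local Open Scope ring_scope.

Section PQBernstein.
Context {R : realType}.

Definition pq_int (p q : R) (n : nat) : R := (p ^+ n - q ^+ n) / (p - q).

Definition pq_fact (p q : R) (n : nat) : R :=
  \prod_(1 <= i < n.+1) pq_int p q i.

Definition pq_binom (p q : R) (n k : nat) : R :=
  pq_fact p q n / (pq_fact p q k * pq_fact p q (n - k)).

(* In the exponent of [p], the subtractions are in [int] and the quotient
   by 2 is exact because the dividend is even. *)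
Definition pq_basis (n k : nat) (p q x : R) : R :=
  p ^ ((k%:Z * (k%:Z - 1) - n%:Z * (n%:Z - 1)) %/ 2)%Z
  * pq_binom p q n k * x ^+ k
  * \prod_(0 <= s < n - k) (p ^+ s - q ^+ s * x).

Definition pq_node (n k : nat) (p q : R) : R :=
  pq_int p q k / (pq_int p q n * p ^ (k%:Z - n%:Z)).

Definition unit_square : set (R * R) := `[0, 1] `*` `[0, 1].

(* Functions on the unit square are represented by total functions on
   [R * R]; for 0 < q < p <= 1 and n > 0 all the nodes lie in [0, 1], so only
   the values of [f] on the unit square matter. *)
Definition pq_bernstein2 (n m : nat) (p1 q1 p2 q2 : R) (f : R * R -> R)
    (z : R * R) : R :=
  \sum_(k < n.+1) \sum_(j < m.+1)
    pq_basis n k p1 q1 z.1 * pq_basis m j p2 q2 z.2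
    * f (pq_node n k p1 q1, pq_node m j p2 q2).

End PQBernstein.

(* Main.v *)
(** Both the basis and the nodes are homogeneous of degree 0 in (p, q), so the
    (p,q)-operator is the q-Bernstein operator of Phillips with parameter
    r = q/p, and p^n drops out. The q-Bernstein basis is the law at time n of a
    Markov chain that moves from k to k+1 with probability r^(n-k) x; one step
    of the chain gives by induction the moments 1, x and x^2 + x(1-x)/[n]_r of
    the nodes. Since [n]_r >= [N]_r >= N r^N for n >= N and r tends to 1, [n]_r
    tends to infinity, so the variance tends to 0 uniformly, and Chebyshev's
    argument in the form |f z - f w| <= e + C |z - w|^2 concludes. *)
Require Import Defs.
From HB Require Import structures.
From mathcomp Require Import all_boot all_order all_algebra.
From mathcomp Require Import all_classical all_reals all_analysis.
From mathcomp Require Import zify ring lra.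

Set Implicit Arguments.
Unset Strict Implicit.
Unset Printing Implicit Defensive.

Import Order.TTheory GRing.Theory Num.Theory.
Import numFieldNormedType.Exports.

Local Open Scope classical_set_scope.
Local Open Scope ring_scope.

(** * The q-integers and q-factorials *)

Section QNumbers.
Context {R : realType}.
Implicit Types (p q x : R) (n k : nat).

Lemma pq_int0 p q : pq_int p q 0 = 0.
Proof. by rewrite /pq_int !expr0 subrr mul0r. Qed.

Lemma pq_intSl q n : q < 1 -> pq_int 1 q n.+1 = 1 + q * pq_int 1 q n.
Proof. by move=> q1; rewrite /pq_int !expr1n exprS; field; lra. Qed.

Lemma pq_intSr q n : q < 1 -> pq_int 1 q n.+1 = pq_int 1 q n + q ^+ n.
Proof. by move=> q1; rewrite /pq_int !expr1n exprS; field; lra. Qed.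

Lemma pq_intD q n k : q < 1 ->
  pq_int 1 q (n + k) = q ^+ k * pq_int 1 q n + pq_int 1 q k.
Proof. by move=> q1; rewrite /pq_int !expr1n exprD; field; lra. Qed.

Lemma pq_int_ge0 q n : 0 <= q < 1 -> 0 <= pq_int 1 q n.
Proof.
move=> /andP[q0 q1]; rewrite /pq_int expr1n divr_ge0 ?subr_ge0 ?(ltW q1)//.
by rewrite exprn_ile1// ltW.
Qed.

Lemma pq_int_gt0 q n : 0 <= q < 1 -> 0 < pq_int 1 q n.+1.
Proof.
move=> /[dup] q01 /andP[q0 q1]; rewrite pq_intSl//.
by rewrite ltr_pwDl// mulr_ge0// pq_int_ge0.
Qed.

Lemma ler_pq_int q n k : 0 <= q < 1 -> (k <= n)%N ->
  pq_int 1 q k <= pq_int 1 q n.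
Proof.
move=> /[dup] q01 /andP[q0 q1] /subnK<-.
by rewrite pq_intD// lerDr mulr_ge0 ?exprn_ge0// pq_int_ge0.
Qed.


(** [pq_int 1 q n] is the sum of the [n] powers [q ^+ i] with [i < n], none of which is below
    [q ^+ n]. *)
Lemma pq_int_ge q n : 0 <= q < 1 -> n%:R * q ^+ n <= pq_int 1 q n.
Proof.
move=> /andP[q0 q1]; elim: n => [|n IH]; first by rewrite mul0r pq_int0.
rewrite pq_intSr// -natr1 mulrDl mul1r.
have qn : q ^+ n.+1 <= q ^+ n by rewrite exprS ler_piMl ?exprn_ge0// ltW.
by rewrite lerD// (le_trans _ IH)// ler_wpM2l.
Qed.

Lemma pq_factS p q n : pq_fact p q n.+1 = pq_fact p q n * pq_int p q n.+1.
Proof. by rewrite /pq_fact big_nat_recr. Qed.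

Lemma pq_fact0 p q : pq_fact p q 0 = 1.
Proof. by rewrite /pq_fact big_geq. Qed.

Lemma pq_fact_gt0 q n : 0 <= q < 1 -> 0 < pq_fact 1 q n.
Proof.
move=> q01; elim: n => [|n IH]; first by rewrite pq_fact0.
by rewrite pq_factS mulr_gt0// pq_int_gt0.
Qed.

(** * Reduction to p = 1 by homogeneity *)

Lemma pq_int_homogeneous p q n : 0 < q < p ->
  pq_int p q n.+1 = p ^+ n * pq_int 1 (q / p) n.+1.
Proof.
move=> /andP[q0 qp]; rewrite /pq_int expr1n expr_div_n !exprS.
by field; rewrite !lt0r_neq0 ?exprn_gt0//; lra.
Qed.

(** The factors have degrees 0, 1, ..., n - 1, which add up to ['C(n, 2)]. *)
Lemma pq_fact_homogeneous p q n : 0 < q < p ->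
  pq_fact p q n = p ^+ 'C(n, 2) * pq_fact 1 (q / p) n.
Proof.
move=> qp; elim: n => [|n IH]; first by rewrite !pq_fact0 mul1r.
by rewrite !pq_factS IH pq_int_homogeneous// binS bin1 exprD mulrACA.
Qed.

Lemma binz2 n : n%:Z * (n%:Z - 1) = 2 * 'C(n, 2)%:Z.
Proof. by elim: n => [//|n IH]; rewrite binS bin1; lia. Qed.

Lemma pq_basis_expE n k :
  ((k%:Z * (k%:Z - 1) - n%:Z * (n%:Z - 1)) %/ 2)%Z = 'C(k, 2)%:Z - 'C(n, 2)%:Z.
Proof. by rewrite !binz2 -mulrBr mulKz. Qed.

(** The powers of [p] cancel: the prefactor has exponent C(k,2) - C(n,2), the binomial C(n,2) -
    C(k,2) - C(n-k,2), and the product C(n-k,2). *)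
Lemma pq_basis_homogeneous p q x n k : 0 < q < p -> (k <= n)%N ->
  pq_basis n k p q x = pq_basis n k 1 (q / p) x.
Proof.
move=> /[dup] qp /andP[q0 qp'] kn.
have p0 : p != 0 by lra.
have r01 : 0 <= q / p < 1 by rewrite divr_ge0 ?ltr_pdivrMr; lra.
rewrite /pq_basis exp1rz mul1r pq_basis_expE expfzDr// -exprnN -!exprnP.
rewrite /pq_binom !(pq_fact_homogeneous _ qp).
have -> : \prod_(0 <= s < n - k) (p ^+ s - q ^+ s * x) =
    p ^+ 'C(n - k, 2) * \prod_(0 <= s < n - k) (1 ^+ s - (q / p) ^+ s * x).
  elim: (n - k)%N => [|j IH]; first by rewrite !big_geq// mul1r.
  rewrite !big_nat_recr//= IH binS bin1 exprD expr1n expr_div_n.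
  by field; rewrite expf_neq0.
by field; rewrite !expf_neq0// !lt0r_neq0// pq_fact_gt0.
Qed.

Lemma pq_node_homogeneous p q n k : 0 < q < p -> (0 < n)%N ->
  pq_node n k p q = pq_int 1 (q / p) k / pq_int 1 (q / p) n.
Proof.
move=> /[dup] qp /andP[q0 qp']; case: n => // n _; rewrite /pq_node.
(* Homogeneity is available for successors only, so the node at [k = 0] is treated apart. *)
case: k => [|k]; first by rewrite !pq_int0 !mul0r.
have p0 : p != 0 by lra.
have r01 : 0 <= q / p < 1 by rewrite divr_ge0 ?ltr_pdivrMr; lra.
rewrite !(pq_int_homogeneous _ qp) expfzDr// -exprnN -exprnP !exprS.
by field; rewrite !expf_neq0// p0 lt0r_neq0// pq_int_gt0.
Qed.

(** * The q-Bernstein basis as a Markov chain, and its moments *)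

Lemma q_basis_ge0 q x n k : 0 <= q < 1 -> 0 <= x <= 1 ->
  0 <= pq_basis n k 1 q x.
Proof.
move=> /[dup] q01 /andP[q0 q1] /andP[x0 x1]; rewrite /pq_basis exp1rz mul1r.
rewrite !mulr_ge0 ?exprn_ge0 ?invr_ge0 ?mulr_ge0 ?(ltW (pq_fact_gt0 _ q01))//.
rewrite prodr_ge0// => s _; rewrite expr1n subr_ge0 mulr_ile1// ?exprn_ge0//.
by rewrite exprn_ile1// ltW.
Qed.

Lemma q_basisS0 q x n : 0 <= q < 1 ->
  pq_basis n.+1 0 1 q x = (1 - q ^+ n * x) * pq_basis n 0 1 q x.
Proof.
move=> q01; rewrite /pq_basis /pq_binom !exp1rz !subn0 big_nat_recr//= expr1n.
by rewrite pq_fact0; field; rewrite !lt0r_neq0 ?pq_fact_gt0.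
Qed.

Lemma q_basisSS q x n : 0 <= q < 1 ->
  pq_basis n.+1 n.+1 1 q x = x * pq_basis n n 1 q x.
Proof.
move=> q01; rewrite /pq_basis /pq_binom !exp1rz !subnn !big_geq// exprS.
by rewrite pq_fact0; field; rewrite !lt0r_neq0 ?pq_fact_gt0.
Qed.

(** With [j = n - k.+1] and common factors removed, this is [n+1] = q^(j+1) [k+1] + [j+1], an
    instance of [pq_intD]. *)
Lemma q_basis_pascal q x n k : 0 <= q < 1 -> (k < n)%N ->
  pq_basis n.+1 k.+1 1 q x = q ^+ (n - k) * x * pq_basis n k 1 q x
    + (1 - q ^+ (n - k.+1) * x) * pq_basis n k.+1 1 q x.
Proof.
move=> /[dup] q01 /andP[q0 q1] /subnK<-; move: (n - k.+1)%N => j.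
rewrite /pq_basis /pq_binom !exp1rz !mul1r.
have -> : ((j + k.+1).+1 - k.+1 = j.+1)%N by lia.
have -> : (j + k.+1 - k = j.+1)%N by lia.
rewrite addnK big_nat_recr//= expr1n !(pq_factS _ _ j) !(pq_factS _ _ k).
rewrite (pq_factS _ _ (j + k.+1)).
have -> : (j + k.+1).+1 = (k.+1 + j.+1)%N by lia.
rewrite (pq_intD _ _ q1) !exprS.
have := pq_int_gt0 j q01; have := pq_int_gt0 k q01.
have := pq_fact_gt0 j q01; have := pq_fact_gt0 k q01.
move=> *; field. by rewrite !lt0r_neq0.
Qed.

(** The dual form of the recurrence: the mean of [g] at time [n.+1] is the mean at time [n] of its
    one-step expectation. *)
Lemma sum_q_basisS q x n (g : nat -> R) : 0 <= q < 1 ->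
  \sum_(k < n.+2) pq_basis n.+1 k 1 q x * g k =
  \sum_(k < n.+1) pq_basis n k 1 q x *
    (g k + q ^+ (n - k) * x * (g k.+1 - g k)).
Proof.
(* The end states [0] and [n.+1] are split off: each is reached in one way only, by staying or by
   moving up. *)
move=> q01; rewrite big_ord_recl big_ord_recr/= /bump/= add1n.
rewrite q_basisS0// q_basisSS//.
under eq_bigr => k _ do rewrite add1n q_basis_pascal// mulrDl.
rewrite big_split/=.
have -> : \sum_(k < n.+1) pq_basis n k 1 q x *
    (g k + q ^+ (n - k) * x * (g k.+1 - g k)) =
  \sum_(k < n.+1) q ^+ (n - k) * x * pq_basis n k 1 q x * g k.+1 +
  \sum_(k < n.+1) (1 - q ^+ (n - k) * x) * pq_basis n k 1 q x * g k.
  by rewrite -big_split/=; apply: eq_bigr => k _; ring.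
rewrite big_ord_recr/= [in RHS]big_ord_recl/= /bump/= subnn subn0 expr0 mul1r.
under [X in _ = _ + (_ + X)]eq_bigr => k _ do rewrite add1n.
by ring.
Qed.

Lemma q_basis_at0 q x : pq_basis 0 0 1 q x = 1.
Proof.
rewrite /pq_basis /pq_binom exp1rz subnn big_geq// pq_fact0 expr0.
by rewrite !mulr1 divr1 ?mul1r.
Qed.

Lemma sum_q_basis q x n : 0 <= q < 1 ->
  \sum_(k < n.+1) pq_basis n k 1 q x = 1.
Proof.
move=> q01; elim: n => [|n IH]; first by rewrite big_ord1 q_basis_at0.
under eq_bigr do rewrite -[pq_basis _ _ _ _ _]mulr1.
rewrite (sum_q_basisS _ _ (fun=> 1))// -[RHS]IH.
by apply: eq_bigr => k _; rewrite subrr mulr0 addr0 mulr1.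
Qed.

(** The increment of [k] is q^k, so the expected increment q^(n-k) x q^k = q^n x is the same in
    every state. *)
Lemma sum_q_basis_int q x n : 0 <= q < 1 ->
  \sum_(k < n.+1) pq_basis n k 1 q x * pq_int 1 q k = pq_int 1 q n * x.
Proof.
move=> /[dup] q01 /andP[q0 q1].
elim: n => [|n IH]; first by rewrite big_ord1 pq_int0 mulr0 mul0r.
rewrite sum_q_basisS// pq_intSr// mulrDl -IH -[q ^+ n * x]mulr1.
rewrite -[X in _ = _ + _ * X](sum_q_basis x n q01) mulr_sumr -big_split/=.
apply: eq_bigr => k _; rewrite pq_intSr//.
have -> : q ^+ n = q ^+ (n - k) * q ^+ k by rewrite -exprD subnK// -ltnS.
by ring.
Qed.

(** The increment of [k]^2 is q^k (1 + (1 + q) [k]), so its expectation needs only the moments of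
    order 0 and 1. *)
Lemma sum_q_basis_int2 q x n : 0 <= q < 1 ->
  \sum_(k < n.+1) pq_basis n k 1 q x * pq_int 1 q k ^+ 2 =
  pq_int 1 q n * x * (1 - x) + (pq_int 1 q n * x) ^+ 2.
Proof.
move=> /[dup] q01 /andP[q0 q1].
elim: n => [|n IH]; first by rewrite big_ord1 pq_int0 !expr2; ring.
rewrite (sum_q_basisS _ _ (fun k => pq_int 1 q k ^+ 2))//.
transitivity (\sum_(k < n.+1) pq_basis n k 1 q x * pq_int 1 q k ^+ 2
  + q ^+ n * x * (\sum_(k < n.+1) pq_basis n k 1 q x
  + (1 + q) * \sum_(k < n.+1) pq_basis n k 1 q x * pq_int 1 q k)).
  rewrite [_ * \sum_(k < _) (_ * _)]mulr_sumr -big_split mulr_sumr -big_split/=.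
  apply: eq_bigr => k _; rewrite pq_intSl//.
  have -> : q ^+ n = q ^+ (n - k) * q ^+ k by rewrite -exprD subnK// -ltnS.
  (* Eliminating [q ^+ k] in favour of [k] leaves a polynomial identity. *)
  have -> : q ^+ k = 1 - (1 - q) * pq_int 1 q k.
    by have := pq_intSl k q1; rewrite pq_intSr// => h; lra.
  by ring.
rewrite IH sum_q_basis// sum_q_basis_int//.
have e : pq_int 1 q n + q ^+ n = 1 + q * pq_int 1 q n.
  by rewrite -pq_intSl// -pq_intSr.
have -> : q ^+ n = 1 - (1 - q) * pq_int 1 q n by lra.
by rewrite pq_intSl//; ring.
Qed.

Lemma q_bernstein_variance q x n : 0 <= q < 1 -> (0 < n)%N ->
  \sum_(k < n.+1) pq_basis n k 1 q x * (pq_int 1 q k / pq_int 1 q n - x) ^+ 2 =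
  x * (1 - x) / pq_int 1 q n.
Proof.
move=> q01; case: n => // n _; have := pq_int_gt0 n q01.
move nE: (pq_int _ _ n.+1) => N N0.
transitivity (N ^- 2 * \sum_(k < n.+2) pq_basis n.+1 k 1 q x * pq_int 1 q k ^+ 2
  - 2 * x / N * \sum_(k < n.+2) pq_basis n.+1 k 1 q x * pq_int 1 q k
  + x ^+ 2 * \sum_(k < n.+2) pq_basis n.+1 k 1 q x).
  rewrite !mulr_sumr -sumrB -big_split/=; apply: eq_bigr => k _.
  by field; rewrite lt0r_neq0.
rewrite sum_q_basis_int2// sum_q_basis_int// sum_q_basis// nE.
by field; rewrite lt0r_neq0.
Qed.

(** This bound is free of [x], which makes the convergence uniform. *)
Lemma q_bernstein_variance_le q x n : 0 <= q < 1 -> (0 < n)%N -> 0 <= x <= 1 ->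
  \sum_(k < n.+1) pq_basis n k 1 q x * (pq_int 1 q k / pq_int 1 q n - x) ^+ 2
  <= (pq_int 1 q n)^-1.
Proof.
move=> q01 n0 x01; rewrite q_bernstein_variance// ler_piMl ?invr_ge0 ?pq_int_ge0//.
by nra.
Qed.

Lemma q_node_itv q n k : 0 <= q < 1 -> (k <= n)%N ->
  0 <= pq_int 1 q k / pq_int 1 q n <= 1.
Proof.
move=> q01 kn; rewrite divr_ge0 ?pq_int_ge0//=.
(* At [n = 0] the quotient is 0, since the inverse of 0 is 0. *)
case: n kn => [|n] kn; first by rewrite pq_int0 invr0 mulr0.
by rewrite ler_pdivrMr ?mul1r ?ler_pq_int// pq_int_gt0.
Qed.

End QNumbers.

(** * Divergence of the q-integers as q tends to 1 *)

Lemma pq_int_cvg_pinfty (R : realType) (r : nat -> R) :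
  (forall n, (1 <= n)%N -> 0 <= r n < 1) -> r n @[n --> \oo] --> (1 : R) ->
  pq_int 1 (r n) n @[n --> \oo] --> +oo.
Proof.
move=> r01 r1; apply/cvgryPge => A.
(* The exponent [N] stays fixed, because [r n ^+ n] need not tend to 1 while [r n ^+ N] does and is
   eventually at least 1/2. *)
have [N NA] : exists N : nat, A <= N%:R / 2.
  exists (Num.bound `|2 * A|); rewrite ler_pdivlMr// mulrC.
  by rewrite (le_trans (ler_norm _))// ltW// archi_boundP.
have rN : r n ^+ N @[n --> \oo] --> (1 : R).
  rewrite -(expr1n R N).
  exact: (cvg_comp r (fun x : R => x ^+ N) r1 (@exprn_continuous R N 1)).
near=> n.
have n1 : (1 <= n)%N by near: n; exists 1%N.
have Nn : (N <= n)%N by near: n; exists N.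
rewrite (le_trans NA)// (le_trans _ (ler_pq_int (r01 _ n1) Nn))//.
rewrite (le_trans _ (pq_int_ge N (r01 _ n1)))// ler_wpM2l//.
near: n; apply: (cvgr_ge _ rN); lra.
Unshelve. all: by end_near.
Qed.

(** * Uniform continuity and the quadratic modulus *)

Section QuadraticModulus.
Context {R : realType}.

(** Heine-Cantor relative to [A]: the near-covering form of compactness merges the radii found near
    each point into a single [d]. *)
Lemma compact_unif_continuous (T : pseudoMetricType R) (A : set T) (f : T -> R)
    (e : R) : compact A -> {within A, continuous f} -> 0 < e ->
  exists2 d : R, 0 < d &
    forall z w, A z -> A w -> ball z d w -> `|f z - f w| <= e.
Proof.
move=> /compact_near_coveringP/near_covering_withinP cA cf e0.
have {cA} Ad : \forall d \near 0^'+,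
    A `<=` [set z | forall w, A w -> ball z d w -> `|f z - f w| <= e].
  apply: cA => z Az.
  have : within A (nbhs z) [set w | `|f z - f w| < e / 2].
    rewrite (nbhs_subspace_in Az).
    apply: ((@cvgrPdist_lt _ _ _ _ _ _ _).1 (cf z)).
    by rewrite divr_gt0.
  move=> /nbhs_ballP[r /= r0 fz].
  near=> z' d => /= Az' w Aw z'w.
  (* Half radii put both [z'] and [w] in the ball of radius [r] about [z]. *)
  have zz' : ball z (r / 2) z'.
    by near: z'; apply: nbhsx_ballx; rewrite divr_gt0.
  have dr : d <= r / 2.
    by near: d; apply: nbhs_right_le; rewrite divr_gt0.
  have fz' : `|f z - f z'| < e / 2.
    apply: fz => //; apply: le_ball zz'.
    by rewrite ler_pdivrMr// ler_peMr ?(ltW r0)// ler1n.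
  have fw : `|f z - f w| < e / 2.
    by apply: fz => //; apply: ball_split zz' _; exact: le_ball z'w.
  rewrite [e]splitr (le_trans _ (ltW (ltrD fz' fw)))//.
  by rewrite (distrC (f z)) ler_distD.
have : \forall d \near 0^'+, 0 < d /\
    A `<=` [set z | forall w, A w -> ball z d w -> `|f z - f w| <= e].
  by apply: filterI => //; exact: nbhs_right_gt.
by move=> /filter_ex[d [d0 dA]]; exists d => // z w Az; exact: dA.
Unshelve. all: by end_near.
Qed.

Lemma unit_square_compact : compact (@unit_square R).
Proof. by apply: compact_setX; exact: segment_compact. Qed.

(** Uniform continuity handles [ball z d w]. Outside it some coordinate differs by at least [d], so
    the sum of squares over [d ^+ 2] is at least 1 and the crude bound on [f] suffices. *)
Lemma quadratic_modulus (f : R * R -> R) (e : R) :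
  {within unit_square, continuous f} -> 0 < e ->
  exists2 C : R, 0 <= C & forall z w, unit_square z -> unit_square w ->
    `|f z - f w| <= e + C * ((z.1 - w.1) ^+ 2 + (z.2 - w.2) ^+ 2).
Proof.
move=> cf e0.
have [d d0 fd] := compact_unif_continuous unit_square_compact cf e0.
have [M [_ fM]] := compact_bounded (continuous_compact cf unit_square_compact).
(* Every number above [M] bounds [f]; [|M| + 1] is one that is also positive. *)
have {}fM z : unit_square z -> `|f z| <= `|M| + 1.
  move=> Az; apply: fM; last by exists z.
  by rewrite (le_lt_trans (ler_norm M))// ltrDl.
exists (2 * (`|M| + 1) / d ^+ 2).
  by rewrite divr_ge0 ?mulr_ge0 ?exprn_ge0 ?addr_ge0 ?(ltW d0).
move=> z w Az Aw; have [zw|zw] := pselect (ball z d w).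
  rewrite (le_trans (fd _ _ Az Aw zw))// lerDl mulr_ge0 ?addr_ge0 ?sqr_ge0//.
  by rewrite divr_ge0 ?mulr_ge0 ?exprn_ge0 ?addr_ge0 ?(ltW d0).
rewrite (le_trans (ler_normB _ _))//.
apply: (@le_trans _ _ (2 * (`|M| + 1))).
  by rewrite mulr_natl mulr2n lerD// fM.
rewrite -[leLHS]add0r lerD ?(ltW e0)// -[leRHS]mulrA ler_peMr ?mulr_ge0 ?addr_ge0//.
rewrite mulrC ler_pdivlMr ?exprn_gt0// mul1r.
have dsqr t : d <= `|t| -> d ^+ 2 <= t ^+ 2.
  move=> dt; rewrite -[t ^+ 2]real_normK ?num_real//.
  by rewrite lerXn2r// nnegrE ltW.
have [zw1|zw1] := lerP d `|z.1 - w.1|.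
  by rewrite -[leLHS]addr0 lerD ?sqr_ge0 ?dsqr.
have [zw2|zw2] := lerP d `|z.2 - w.2|.
  by rewrite -[leLHS]add0r lerD ?sqr_ge0 ?dsqr.
(* Balls of the product are products of balls. *)
by exfalso; apply: zw; split.
Qed.

End QuadraticModulus.

(** * Averaging over the nodes, and uniform convergence *)

Lemma dist_average2_le (R : realDomainType) (n m : nat) (u v : nat -> R)
    (g : nat -> nat -> R) (a b : nat -> R) (c e : R) :
  (forall k, (k <= n)%N -> 0 <= u k) -> (forall j, (j <= m)%N -> 0 <= v j) ->
  \sum_(k < n.+1) u k = 1 -> \sum_(j < m.+1) v j = 1 ->
  (forall k j, (k <= n)%N -> (j <= m)%N -> `|c - g k j| <= e + (a k + b j)) ->
  `|c - \sum_(k < n.+1) \sum_(j < m.+1) u k * v j * g k j| <=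
  e + (\sum_(k < n.+1) u k * a k + \sum_(j < m.+1) v j * b j).
Proof.
move=> u0 v0 u1 v1 gc.
(* The weights [u i * v j] have total mass 1 and marginals [u] and [v], so constants and functions
   of one index can be moved under the double sum. *)
have E (r : R) (h k : nat -> R) : r + (\sum_(i < n.+1) u i * h i +
    \sum_(j < m.+1) v j * k j) =
    \sum_(i < n.+1) \sum_(j < m.+1) u i * v j * (r + (h i + k j)).
  transitivity (\sum_(i < n.+1)
      (u i * r + u i * h i + u i * \sum_(j < m.+1) v j * k j)).
    by rewrite !big_split/= -!mulr_suml u1 !mul1r addrA.
  apply: eq_bigr => i _; rewrite -[u i * r]mulr1 -[u i * h i]mulr1 -v1.
  by rewrite !mulr_sumr -!big_split; apply: eq_bigr => j _ /=; ring.
have -> : c = \sum_(k < n.+1) \sum_(j < m.+1) u k * v j * c.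
  under [RHS]eq_bigr do rewrite -mulr_suml -mulr_sumr v1 mulr1.
  by rewrite -mulr_suml u1 mul1r.
rewrite E -sumrB (le_trans (ler_norm_sum _ _ _))//; apply: ler_sum => k _.
rewrite -sumrB (le_trans (ler_norm_sum _ _ _))//; apply: ler_sum => j _.
have kn : (k <= n)%N by rewrite -ltnS.
have jm : (j <= m)%N by rewrite -ltnS.
rewrite -mulrBr normrM ger0_norm ?mulr_ge0 ?u0 ?v0//.
by rewrite ler_wpM2l ?mulr_ge0 ?u0 ?v0// gc.
Qed.

(** Averaging the quadratic bound over the nodes turns each square into a variance. *)
Lemma pq_bernstein2_dist_le (R : realType) (n m : nat) (p1 q1 p2 q2 e C : R)
    (f : R * R -> R) (z : R * R) :
  0 < q1 < p1 -> 0 < q2 < p2 -> (0 < n)%N -> (0 < m)%N -> 0 <= C ->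
  (forall w, unit_square w ->
    `|f z - f w| <= e + C * ((z.1 - w.1) ^+ 2 + (z.2 - w.2) ^+ 2)) ->
  unit_square z ->
  `|f z - pq_bernstein2 n m p1 q1 p2 q2 f z| <=
  e + C * ((pq_int 1 (q1 / p1) n)^-1 + (pq_int 1 (q2 / p2) m)^-1).
Proof.
move=> qp1 qp2 n0 m0 C0 fC [/=]; rewrite !in_itv/= => z1 z2.
have r01 (p q : R) : 0 < q < p -> 0 <= q / p < 1.
  by move=> /andP[q0 qp]; rewrite divr_ge0 ?ltr_pdivrMr; lra.
have r1 := r01 _ _ qp1; have r2 := r01 _ _ qp2.
rewrite /pq_bernstein2.
under eq_bigr => k _.
  under eq_bigr => j _.
    rewrite !pq_node_homogeneous// pq_basis_homogeneous// -1?ltnS//.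
    rewrite (pq_basis_homogeneous _ qp2) -1?ltnS//.
  over.
over.
pose a q x n k : R := C * (pq_int 1 q k / pq_int 1 q n - x) ^+ 2.
rewrite (le_trans (@dist_average2_le _ _ _ (fun k => pq_basis n k 1 (q1 / p1) z.1)
  (fun j => pq_basis m j 1 (q2 / p2) z.2) (fun k j =>
    f (pq_int 1 (q1 / p1) k / pq_int 1 (q1 / p1) n,
       pq_int 1 (q2 / p2) j / pq_int 1 (q2 / p2) m))
  (a (q1 / p1) z.1 n) (a (q2 / p2) z.2 m) (f z) e _ _ _ _ _))//.
- by move=> k _; exact: q_basis_ge0.
- by move=> k _; exact: q_basis_ge0.
- exact: sum_q_basis.
- exact: sum_q_basis.
- move=> k j kn jm; rewrite -mulrDr (le_trans (fC _ _))//=.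
    by split; rewrite /= in_itv/= q_node_itv.
  by rewrite -!(sqrrN (_ / _ - _)) !opprB.
rewrite lerD2l mulrDr lerD//.
  under eq_bigr do rewrite mulrCA.
  by rewrite -mulr_sumr ler_wpM2l// q_bernstein_variance_le.
under eq_bigr do rewrite mulrCA.
by rewrite -mulr_sumr ler_wpM2l// q_bernstein_variance_le.
Qed.

Theorem theorem2p5 (R : realType) (p1 q1 p2 q2 : nat -> R) (a1 a2 : R)
  (hpq1 : forall n : nat, (1 <= n)%N -> 0 < q1 n /\ q1 n < p1 n /\ p1 n <= 1)
  (hpq2 : forall m : nat, (1 <= m)%N -> 0 < q2 m /\ q2 m < p2 m /\ p2 m <= 1)
  (hp1 : p1 n @[n --> \oo] --> (1 : R))
  (hq1 : q1 n @[n --> \oo] --> (1 : R))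
  (hp2 : p2 m @[m --> \oo] --> (1 : R))
  (hq2 : q2 m @[m --> \oo] --> (1 : R))
  (ha1 : p1 n ^+ n @[n --> \oo] --> a1)
  (ha2 : p2 m ^+ m @[m --> \oo] --> a2)
  (f : R * R -> R)
  (hf : {within unit_square, continuous f}) :
  {uniform unit_square,
    (fun nm : nat * nat =>
       pq_bernstein2 nm.1 nm.2 (p1 nm.1) (q1 nm.1) (p2 nm.2) (q2 nm.2) f)
      @ (\oo, \oo) --> f}.
Proof.
move=> P; rewrite uniform_nbhs /= => -[E [+ EP]].
rewrite -entourage_ballE => -[e /= e0 eE].
(* The error [e] is split into e/2 for the modulus and e/4 for each variance. *)
have [C C0 fC] := quadratic_modulus hf (divr_gt0 e0 (ltr0n _ 2)).
have large (p q : nat -> R) :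
    (forall n, (1 <= n)%N -> 0 < q n /\ q n < p n /\ p n <= 1) ->
    p n @[n --> \oo] --> (1 : R) -> q n @[n --> \oo] --> (1 : R) ->
    \forall n \near \oo, (1 <= n)%N /\ C * (pq_int 1 (q n / p n) n)^-1 < e / 4.
  move=> hpq hp hq.
  have r01 n : (1 <= n)%N -> 0 <= q n / p n < 1.
    by move=> /hpq[q0 [qp _]]; rewrite divr_ge0 ?ltr_pdivrMr; lra.
  have r1 : q n / p n @[n --> \oo] --> (1 : R).
    by rewrite -(divr1 1); apply: cvgM => //; apply: cvgV.
  (* Taking [C + 1] instead of [C] makes the final inequality strict. *)
  have /cvgryPge /(_ ((C + 1) * 4 / e)) := pq_int_cvg_pinfty r01 r1.
  move=> nC; near=> n.
  have n1 : (1 <= n)%N by near: n; exists 1%N.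
  split=> //.
  have : (C + 1) * 4 / e <= pq_int 1 (q n / p n) n by near: n.
  have := pq_int_gt0 n.-1 (r01 n n1); rewrite prednK// => N0.
  rewrite ler_pdivrMr// ltr_pdivrMr// => ?; lra.
(* The product filter asks for one set of indices [n] and one of indices [m], chosen
   independently. *)
exists ([set n | (1 <= n)%N /\ C * (pq_int 1 (q1 n / p1 n) n)^-1 < e / 4],
        [set n | (1 <= n)%N /\ C * (pq_int 1 (q2 n / p2 n) n)^-1 < e / 4]).
  by split; exact: large.
move=> [n m] /= [[n1 nC] [m1 mC]]; apply: EP => z Az; apply: eE.
rewrite /ball/=.
have [? [? _]] := hpq1 _ n1; have [? [? _]] := hpq2 _ m1.
apply: (@le_lt_trans _ _ (e / 2 + C * ((pq_int 1 (q1 n / p1 n) n)^-1 +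
    (pq_int 1 (q2 m / p2 m) m)^-1))).
  by apply: pq_bernstein2_dist_le => //; [lra|lra|move=> w; exact: fC].
rewrite mulrDr; lra.
Unshelve. all: by end_near.
Qed.
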